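(* Let $G$ be an interval graph with at least one edge, and let $\psi=\psi(G)$ be its claw number. Then $$\lceil \log_2 \psi\rceil \le \mathrm{cub}(G)\le \lceil \log_2\psi\rceil+2 .$$
   Context: All graphs are finite, simple and undirected. A graph is an interval graph if its vertices can be mapped to closed intervals on the real line so that two distinct vertices are adjacent if and only if their intervals intersect. A $b$-dimensional cube is a Cartesian product $I_1\times\cdots\times I_b$ where each $I_i$ is a closed interval of unit length on the real line. The cubicity $\mathrm{cub}(G)$ of a graph $G$ is the minimum positive integer $b$ such that the vertices of $G$ can be mapped to axis-parallel $b$-dimensional cubes so that two distinct vertices are adjacent in $G$ if and only if their assigned cubes intersect. For $m\ge 1$, $S(m)$ denotes the star graph $K_{1,m}$ on $m+1$ vertices. The claw number $\psi(G)$ of a graph $G$ is the largest positive integer $m$ such that $S(m)$ is an induced subgraph of $G$; it is defined exactly when $G$ has at least one edge. *)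

(* Defs.v *)
From mathcomp Require Export all_boot all_order all_algebra.
From mathcomp Require Export boolp classical_sets set_interval reals exp.

Set Implicit Arguments.
Unset Strict Implicit.
Unset Printing Implicit Defensive.

Import Order.TTheory GRing.Theory Num.Theory.
Local Open Scope ring_scope.
Local Open Scope classical_set_scope.

Record sgraph := SGraph {
  vertex :> finType;
  adj : rel vertex;
  adj_sym : symmetric adj;
  adj_irrefl : irreflexive adj }.

Definition represents (G : sgraph) (X : Type) (S : G -> set X) : Prop :=
  forall u v : G, u != v -> (adj u v <-> S u `&` S v !=set0).

Definition interval_graph (R : realType) (G : sgraph) : Prop :=
  exists l r : G -> R,
    (forall v, l v <= r v) /\ represents (fun v => `[l v, r v]).

(* The axis-parallel cube with lower corner [c]; points are functions on 'I_b. *)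
Definition cube (R : realType) (b : nat) (c : 'I_b -> R) : set ('I_b -> R) :=
  [set x | forall i, `[c i, c i + 1] (x i)].

Definition cube_representable (R : realType) (G : sgraph) (b : nat) : Prop :=
  exists c : G -> 'I_b -> R, represents (fun v => cube (c v)).

(* Coordinate w separates w from its non-neighbours and nothing else:
   w starts at 0, its neighbours at 1, the other vertices at 2. *)
Lemma ex_cube_representable (R : realType) (G : sgraph) :
  exists b, `[< (0 < b)%N /\ cube_representable R G b >].
Proof.
exists #|G|.+1; apply/asboolP; split=> //.
pose k (w v : G) : nat := if v == w then 0 else if adj w v then 1 else 2.
pose c (v : G) (i : 'I_#|G|.+1) : R :=
  if [pick w : G | enum_rank w == i :> nat] is Some w then (k w v)%:R else 0.
have cE v w : c v (widen_ord (leqnSn _) (enum_rank w)) = (k w v)%:R.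
  rewrite /c; case: pickP => [w'|/(_ w)]; last by rewrite /= eqxx.
  by move=> /eqP/val_inj/enum_rank_inj ->.
exists c => u v uv; split=> [auv|[x [xu xv]]].
  exists (fun i => Num.max (c u i) (c v i)).
  have key i : c u i <= c v i + 1 /\ c v i <= c u i + 1.
    rewrite /c; case: pickP => [w _|_]; last by rewrite add0r ler01.
    have avu : adj v u by rewrite adj_sym.
    rewrite !natr1 !ler_nat /k.
    have [uw|_] := eqVneq u w.
      by rewrite -uw auv; case: (v == u).
    have [vw|_] := eqVneq v w; first by rewrite -vw avu.
    by case: (adj w u); case: (adj w v).
  split=> i /=; have [h1 h2] := key i; rewrite in_itv /= le_max ge_max lexx.
    by rewrite lerDl ler01.
  by rewrite orbT h1 lerDl ler01.
apply: contrapT => /negP nauv.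
have := xu (widen_ord (leqnSn _) (enum_rank u)).
have := xv (widen_ord (leqnSn _) (enum_rank u)).
rewrite /= !cE /k eqxx (negbTE nauv) eq_sym (negbTE uv) !in_itv /= add0r.
by move=> /andP[h1 _] /andP[_ h2]; have := le_trans h1 h2; rewrite (ler_nat R 2 1).
Qed.

Definition cubicity (R : realType) (G : sgraph) : nat :=
  ex_minn (ex_cube_representable R G).

Lemma cubicityP (R : realType) (G : sgraph) :
  [/\ (0 < cubicity R G)%N, cube_representable R G (cubicity R G) &
      forall b, (0 < b)%N -> cube_representable R G b ->
        (cubicity R G <= b)%N].
Proof.
rewrite /cubicity; case: ex_minnP => b /asboolP[b0 rb] minb; split=> // b' ? ?.
by apply: minb; apply/asboolP.
Qed.

(* Vertex [ord0] is the centre. *)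
Definition star_adj (m : nat) : rel 'I_m.+1 :=
  fun i j => (i == ord0) (+) (j == ord0).

Lemma star_adj_sym m : symmetric (@star_adj m).
Proof. by move=> i j; rewrite /star_adj addbC. Qed.

Lemma star_adj_irrefl m : irreflexive (@star_adj m).
Proof. by move=> i; rewrite /star_adj addbb. Qed.

Definition star (m : nat) : sgraph :=
  SGraph (@star_adj_sym m) (@star_adj_irrefl m).

Definition induced_subgraph (H G : sgraph) : bool :=
  [exists f : {ffun H -> G},
    injectiveb f && [forall x, forall y, adj (f x) (f y) == adj x y]].

(* The bound loses nothing, since S(m) has m + 1 vertices; the value is the
   junk 0 when G has no edge. *)
Definition claw_number (G : sgraph) : nat :=
  \max_(m < #|G| | (0 < m)%N && induced_subgraph (star m) G) m.

Lemma claw_numberP (G : sgraph) : (exists u v : G, adj u v) ->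
  [/\ (0 < claw_number G)%N, induced_subgraph (star (claw_number G)) G &
      forall m, (0 < m)%N -> induced_subgraph (star m) G ->
        (m <= claw_number G)%N].
Proof.
have max m : (0 < m)%N -> induced_subgraph (star m) G ->
    exists2 i : 'I_#|G|, (0 < i)%N && induced_subgraph (star i) G & i = m :> nat.
  move=> m0 sm; have mG : (m < #|G|)%N.
    have /existsP[f /andP[/injectiveP finj _]] := sm.
    by have := leq_card f finj; rewrite card_ord.
  by exists (Ordinal mG); rewrite //= m0.
move=> [u [v auv]]; have s1 : induced_subgraph (star 1) G.
  apply/existsP; exists [ffun i : star 1 => if i == ord0 then u else v].
  have uv : u != v by apply: contraTneq auv => ->; rewrite adj_irrefl.
  apply/andP; split.
    apply/injectiveP => i j; rewrite !ffunE.
    case: (eqVneq i ord0) => [->|i0]; case: (eqVneq j ord0) => [->|j0] //.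
    - by move/eqP; rewrite (negbTE uv).
    - by move/eqP; rewrite eq_sym (negbTE uv).
    - by case: i j i0 j0 => [[|[|i]] hi] [[|[|j]] hj] // *; apply: val_inj.
  apply/forallP => i; apply/forallP => j; rewrite !ffunE /= /star_adj.
  by case: (i == ord0); case: (j == ord0); rewrite /= ?adj_irrefl ?(adj_sym v) ?auv.
have [i0 Pi0 _] := max 1%N isT s1.
have [|i /andP[ipos si] cE] := @eq_bigmax_cond _
  [pred m : 'I_#|G| | (0 < m)%N && induced_subgraph (star m) G]
  (fun m => m : nat).
  by apply/card_gt0P; exists i0.
split=> [||m m0 sm]; [by rewrite /claw_number cE..|].
have [j Pj <-] := max m m0 sm.
exact: (@leq_bigmax_cond _
  [pred m : 'I_#|G| | (0 < m)%N && induced_subgraph (star m) G]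
  (fun m => m : nat) j Pj).
Qed.

Definition log2 (R : realType) (x : R) : R := ln x / ln 2.

(* Main.v *)
(* Two cubes meet iff their corners differ by at most 1 in every coordinate.

   Lower bound: pairwise disjoint unit cubes all meeting one unit cube lie on
   different sides of it, i.e. have different sign vectors, so psi <= 2 ^ b.

   Upper bound: let the level of v be the largest size of an independent set
   lying entirely to the left of the interval of v. Levels increase strictly
   from u to v when u is left of v, and differ by less than psi when u and v are
   adjacent. Choose psi <= 2 ^ t. The t low bits of the level, refined by
   endpoints, separate non-adjacent vertices whose levels lie in the same block
   of length 2 ^ t; adjacent vertices lie in the same or in consecutive blocks.
   Two further coordinates handle different blocks, one separating consecutive
   blocks 2k and 2k+1, the other 2k+1 and 2k+2, and both separating blocks
   further apart. *)

Require Import Defs.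
From mathcomp Require Import lra zify.

Set Implicit Arguments.
Unset Strict Implicit.
Unset Printing Implicit Defensive.

Import Order.TTheory GRing.Theory Num.Theory.
Local Open Scope ring_scope.

(** * Intersection criteria and the lower bound *)

Lemma itv_meet (R : realType) (a b c d : R) : a <= b -> c <= d ->
  (`[a, b]%classic `&` `[c, d]%classic !=set0)%classic <->
  (a <= d) && (c <= b).
Proof.
move=> ab cd; split=> [[x [/=]]|/andP[ad cb]].
  rewrite !in_itv /= => /andP[ax xb] /andP[cx xd].
  by rewrite (le_trans ax xd) (le_trans cx xb).
exists (Num.max a c); split; rewrite /= in_itv /= le_max ge_max lexx ?orbT /=.
  by rewrite ab.
by rewrite ad.
Qed.

Lemma cube_meet (R : realType) (b : nat) (c d : 'I_b -> R) :
  (cube c `&` cube d !=set0)%classic <-> forall i, `|c i - d i| <= 1.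
Proof.
have itv1 i : (`|c i - d i| <= 1) = (c i <= d i + 1) && (d i <= c i + 1).
  by rewrite ler_norml; apply/idP/idP => /andP[? ?]; apply/andP; split; lra.
have le1 (x : R) : x <= x + 1 by rewrite lerDl ler01.
split=> [[x [cx dx]] i|cd].
  by rewrite itv1; apply/itv_meet => //; exists (x i); split.
have /choice[x xP] i : exists x, (`[c i, c i + 1] `&` `[d i, d i + 1])%classic x.
  by apply/itv_meet => //; rewrite -itv1.
by exists x; split=> i; have [] := xP i.
Qed.

Lemma star_le_cube (R : realType) (G : sgraph) (m b : nat) :
  induced_subgraph (star m) G -> cube_representable R G b -> (m <= 2 ^ b)%N.
Proof.
move=> /existsP[f /andP[/injectiveP finj /forallP fadj]] [c cP].
have {}fadj x y : adj (f x) (f y) = star_adj x y by have /forallP/(_ y)/eqP := fadj x.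
pose s (i : 'I_m) : {ffun 'I_b -> bool} :=
  [ffun k => c (f (lift ord0 i)) k <= c (f ord0) k].
have leaf i k : `|c (f (lift ord0 i)) k - c (f ord0) k| <= 1.
  move: k; apply/cube_meet/cP; first by rewrite (inj_eq finj).
  by rewrite fadj /star_adj.
suff /leq_card : injective s.
  by rewrite card_ord card_ffun card_bool card_ord.
move=> i j /ffunP sij; apply/eqP/contraT => ij.
have neq : f (lift ord0 i) != f (lift ord0 j).
  by rewrite (inj_eq finj) (inj_eq (@lift_inj _ _)).
suff : adj (f (lift ord0 i)) (f (lift ord0 j)) by rewrite fadj.
apply/(cP _ _ neq)/cube_meet => k.
(* Equal signs put both leaves on the same side of the centre in coordinate [k], each within
   distance 1 of it, hence within distance 1 of each other. *)
have := leaf i k; have := leaf j k; have := sij k; rewrite !ffunE !ler_norml.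
move=> + /andP[? ?] /andP[? ?].
case: (lerP (c (f (lift ord0 i)) k)) => ?; case: (lerP (c (f (lift ord0 j)) k)) => ? // _;
  apply/andP; split; lra.
Qed.

(** * Independent sets, claws and binary digits *)

Definition independent (G : sgraph) (A : {set G}) : bool :=
  [forall x in A, forall y in A, ~~ adj x y].

Lemma independentP (G : sgraph) (A : {set G}) :
  reflect {in A &, forall x y, ~~ adj x y} (independent A).
Proof.
apply: (iffP forall_inP) => [h x y xA yA|h x xA].
  by have /forall_inP/(_ y yA) := h x xA.
by apply/forall_inP => y yA; apply: h.
Qed.

Lemma leq_claw_number (G : sgraph) (u : G) (A : {set G}) :
  independent A -> {in A, forall x, adj u x} -> (#|A| <= claw_number G)%N.
Proof.
(* [claw_numberP] requires an edge; a member of a nonempty [A] provides one. *)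
move=> /independentP indA uA; have [->//|[x0 x0A]] : #|A| = 0%N \/ exists x, x \in A.
  by have [->|[x]] := set_0Vmem A; [left; rewrite cards0|right; exists x].
have [_ _ max] := claw_numberP (ex_intro _ u (ex_intro _ x0 (uA x0 x0A))).
apply: max; first by apply/card_gt0P; exists x0.
pose f (i : star #|A|) : G := if unlift ord0 i is Some j then enum_val j else u.
have f0 : f ord0 = u by rewrite /f unlift_none.
have fS j : f (lift ord0 j) = enum_val j by rewrite /f liftK.
have unA (j : 'I_#|A|) : u != enum_val j.
  have := uA _ (enum_valP j); apply: contraTneq => <-.
  by rewrite adj_irrefl.
apply/existsP; exists (finfun f); apply/andP; split.
  apply/injectiveP => i j; rewrite !ffunE.
  case: (unliftP ord0 i) => [i'|] ->; case: (unliftP ord0 j) => [j'|] ->;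
    rewrite ?f0 ?fS => // e.
  - by rewrite (enum_val_inj e).
  - by have := unA i'; rewrite e eqxx.
  - by have := unA j'; rewrite e eqxx.
apply/forallP => i; apply/forallP => j; rewrite !ffunE /= /star_adj.
case: (unliftP ord0 i) => [i'|] ->; case: (unliftP ord0 j) => [j'|] ->;
  rewrite ?f0 ?fS /= ?adj_irrefl //.
- by rewrite (negbTE (indA _ _ (enum_valP i') (enum_valP j'))).
- by rewrite adj_sym uA ?enum_valP.
- by rewrite uA ?enum_valP.
Qed.

(** The witness is the highest binary digit in which [a] and [b] differ; there the larger number has
    the 1. *)
Lemma bit_separation (t a b : nat) : (a < b)%N ->
  (a %/ 2 ^ t = b %/ 2 ^ t)%N ->
  exists2 i, (i < t)%N & ~~ odd (a %/ 2 ^ i) && odd (b %/ 2 ^ i).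
Proof.
move=> ab; elim: t => [|t IH]; first by rewrite !divn1; lia.
have [/IH[i it h] _|ne] := eqVneq (a %/ 2 ^ t)%N (b %/ 2 ^ t)%N.
  by exists i => //; lia.
have := leq_div2r (2 ^ t) (ltnW ab); rewrite expnSr !divnMA => le e.
by exists t => //; move: le ne e; set x := (a %/ _)%N; set y := (b %/ _)%N; lia.
Qed.

(** * Levels and the upper bound *)

Section IntervalRepresentation.
Variables (R : realType) (G : sgraph) (l r : G -> R).
Hypothesis lr : forall v, l v <= r v.
Hypothesis adjE : forall u v, u != v -> adj u v = (l u <= r v) && (l v <= r u).

Let adj_overlap u v : adj u v -> (l u <= r v) && (l v <= r u).
Proof.
have [->|uv] := eqVneq u v; first by rewrite adj_irrefl.
by rewrite adjE.
Qed.

Definition left_independent (v : G) (A : {set G}) : bool :=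
  independent A && [forall x in A, r x < l v].

Definition level (v : G) : nat := \max_(A | left_independent v A) #|A|.

Lemma level_witness (v : G) : exists2 A, left_independent v A & #|A| = level v.
Proof.
have [|A vA AE] := @eq_bigmax_cond _ (left_independent v) (fun A : {set G} => #|A|).
  apply/card_gt0P; exists finset.set0; apply/andP; split.
    by apply/independentP => x; rewrite inE.
  by apply/forall_inP => x; rewrite inE.
by exists A.
Qed.

Lemma leq_level (v : G) (A : {set G}) :
  left_independent v A -> (#|A| <= level v)%N.
Proof. exact: (@leq_bigmax_cond _ _ (fun A : {set G} => #|A|)). Qed.

(** A largest independent set left of [u] can be enlarged by [u] itself. *)
Lemma level_lt (u v : G) : r u < l v -> (level u < level v)%N.
Proof.
move=> uv; have [A /andP[/independentP indA /forall_inP Au] <-] := level_witness u.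
have nadj x : x \in A -> ~~ adj x u.
  move=> xA; apply/negP => /adj_overlap /andP[_]; rewrite leNgt.
  by rewrite Au.
have uA : u \notin A by apply/negP => /Au; rewrite ltNge lr.
suff : left_independent v (u |: A).
  by move/leq_level; rewrite cardsU1 uA.
apply/andP; split.
  apply/independentP => x y /setU1P[->|xA] /setU1P[->|yA].
  - by rewrite adj_irrefl.
  - by rewrite adj_sym nadj.
  - exact: nadj.
  - exact: indA.
apply/forall_inP => x /setU1P[->//|/Au xu].
exact: lt_trans (lt_le_trans xu (lr u)) uv.
Qed.

(* Of a largest independent set left of [v], the members not left of [u] form,
   together with [v], the leaves of an induced star centred at [u]. *)
Lemma level_adj (u v : G) : adj u v -> (level v < level u + claw_number G)%N.
Proof.
move=> auv; have /andP[uv vu] := adj_overlap auv.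
have [A /andP[/independentP indA /forall_inP Av] <-] := level_witness v.
pose B := [set x | r x < l u].
rewrite -(cardsID B A) -addnS leq_add //.
  apply: leq_level; apply/andP; split.
    by apply/independentP => x y /setIP[xA _] /setIP[yA _]; apply: indA.
  by apply/forall_inP => x /setIP[_]; rewrite inE.
have nadj x : x \in A -> ~~ adj x v.
  by move=> /Av xv; apply/negP => /adj_overlap /andP[_]; rewrite leNgt xv.
have vA : v \notin A :\: B.
  by apply/negP => /setDP[/Av]; rewrite ltNge lr.
suff : (#|v |: (A :\: B)| <= claw_number G)%N by rewrite cardsU1 vA.
apply: (@leq_claw_number _ u).
  apply/independentP => x y /setU1P[->|/setDP[xA _]] /setU1P[->|/setDP[yA _]].
  - by rewrite adj_irrefl.
  - by rewrite adj_sym nadj.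
  - exact: nadj.
  - exact: indA.
move=> x /setU1P[->//|/setDP[xA]]; rewrite inE -leNgt => ux.
rewrite adjE; last by apply: contraTneq auv => ->; apply: nadj.
by rewrite ux (le_trans (lr x)) // (le_trans (ltW (Av x xA))).
Qed.

(* Positions [2k - 1] and [2k] share the integer part [k], hence are too close to
   be separated, while between positions [2k] and [2k + 1] the comparison of
   [r u] with [l v] decides. *)
Definition coord (n : nat) (v : G) : R :=
  (uphalf n)%:R + if odd n then l v else r v.

Hypothesis small : forall u v, `|l u| <= 2^-1 /\ `|r v| <= 2^-1.

Lemma coord_le (n m : nat) (u v : G) :
  l v <= r u -> (m <= n.+1)%N -> coord m v - coord n u <= 1.
Proof.
move=> vu mn; rewrite /coord.
have [] := small u u; have [] := small v v; rewrite !ler_norml.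
move=> /andP[? ?] /andP[? ?] /andP[? ?] /andP[? ?].
have [le|lt] := leqP (uphalf m) (uphalf n).
  move: le; rewrite -(ler_nat R).
  by case: (odd m); case: (odd n) => ?; lra.
(* The integer part grows only for even [n] and [m = n.+1]; the offsets are then [r u] and [l v],
   whose order is given. *)
have [mE /negbTE n2] : m = n.+1 /\ ~~ odd n by lia.
rewrite mE /= n2 /= uphalf_half n2 add0n -natr1; lra.
Qed.

Lemma coord_gt (n m : nat) (u v : G) :
  r u < l v -> (uphalf n < uphalf m)%N -> 1 < coord m v - coord n u.
Proof.
move=> uv; rewrite -(ler_nat R) -natr1 /coord; have := lr u; have := lr v.
by case: (odd m); case: (odd n) => ? ? ?; lra.
Qed.

Lemma cube_representable_interval (t : nat) :
  (claw_number G <= 2 ^ t)%N -> cube_representable R G t.+2.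
Proof.
(* Coordinates below [t] use bits of the level. The last two use the block index and its successor,
   so that their integer parts jump after even and after odd blocks respectively. *)
move=> ht; pose n i v :=
  if (i < t)%N then nat_of_bool (odd (level v %/ 2 ^ i))
  else (level v %/ 2 ^ t + (i - t))%N.
exists (fun v i => coord (n i v) v) => u v uv; rewrite cube_meet.
have t0 : (0 < 2 ^ t)%N by rewrite expn_gt0.
have block x y : adj x y -> (level y %/ 2 ^ t <= (level x %/ 2 ^ t).+1)%N.
  move=> /level_adj lt.
  have : (level y <= level x + 2 ^ t)%N by lia.
  by move/(leq_div2r (2 ^ t)); rewrite divnDr // divnn t0; lia.
have close x y i : adj x y -> coord (n i y) y - coord (n i x) x <= 1.
  move=> axy; have /andP[_ yx] := adj_overlap axy.
  apply: coord_le => //; rewrite /n; case: ifP => _; first by case: odd; case: odd.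
  by have := block _ _ axy; lia.
split=> [auv i|near].
  have := close _ _ i auv; rewrite adj_sym in auv; have := close _ _ i auv.
  by rewrite ler_norml => ? ?; apply/andP; split; lra.
have far x y : r x < l y -> exists i : 'I_t.+2, (uphalf (n i x) < uphalf (n i y))%N.
  move=> xy; have lxy := level_lt xy.
  have := leq_div2r (2 ^ t) (ltnW lxy); rewrite leq_eqVlt => /orP[/eqP e|lt].
    have [i it /andP[/negbTE bx by_]] := bit_separation lxy e.
    have it2 : (i < t.+2)%N by lia.
    by exists (Ordinal it2); rewrite /n /= it bx by_.
  (* The shift [a] makes the position of [x] even, and any position beyond an even one has a larger
     integer part. *)
  pose a : nat := odd (level x %/ 2 ^ t).
  have at2 : (t + a < t.+2)%N by rewrite /a; lia.
  exists (Ordinal at2); rewrite /n /= (ltnNge (t + a)) leq_addr /= addKn /a.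
  by move: lt; set p := (level x %/ _)%N; set q := (level y %/ _)%N; lia.
have nfar x y : (forall i : 'I_t.+2, `|coord (n i x) x - coord (n i y) y| <= 1) ->
    l y <= r x.
  move=> xy; rewrite leNgt; apply/negP => lt; have [i lti] := far _ _ lt.
  have := coord_gt lt lti; have := xy i; rewrite ler_norml => /andP[? ?] ?; lra.
rewrite adjE // (nfar _ _ near) andbT; apply: nfar => i.
by rewrite distrC.
Qed.

End IntervalRepresentation.

(** * Normalised intervals and the final bounds *)

Lemma interval_graph_small (R : realType) (G : sgraph) :
  interval_graph R G -> exists l r : G -> R,
    [/\ forall v, l v <= r v,
        forall u v, u != v -> adj u v = (l u <= r v) && (l v <= r u) &
        forall u v, `|l u| <= 2^-1 /\ `|r v| <= 2^-1].
Proof.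
move=> [l [r [lr lrP]]].
(* The summand 1 keeps [M] positive, so dividing by [2 * M] preserves the order of endpoints. *)
pose M : R := 1 + \sum_v (`|l v| + `|r v|).
have M0 : 0 < M.
  by rewrite ltr_wpDr ?ltr01 // sumr_ge0 // => v _; rewrite addr_ge0.
have M2 : 0 < 2 * M by rewrite mulr_gt0.
have bnd v : `|l v| + `|r v| <= M.
  rewrite /M (bigD1 v) //= addrA -[leLHS]addr0 lerD //; first by rewrite lerDr.
  by rewrite sumr_ge0 // => w _; rewrite addr_ge0.
exists (fun v => l v / (2 * M)), (fun v => r v / (2 * M)); split=> [v|u v uv|u v].
- by rewrite ler_pM2r ?invr_gt0.
- rewrite !ler_pM2r ?invr_gt0 //; apply/idP/idP => [/(lrP _ _ uv)/itv_meet|h]; first exact.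
  by apply/(lrP _ _ uv)/itv_meet.
have half x : `|x| <= M -> `|x / (2 * M)| <= 2^-1.
  move=> xM; rewrite normrM normfV (gtr0_norm M2) ler_pdivrMr //.
  by rewrite mulKf ?pnatr_eq0.
by split; apply: half; [have := bnd u|have := bnd v]; apply: le_trans;
  rewrite ?lerDl ?lerDr.
Qed.

Lemma ceil_log2_le (R : realType) (m n : nat) : (0 < m)%N ->
  (Num.ceil (log2 (m%:R : R)) <= n%:Z) = (m <= 2 ^ n)%N.
Proof.
move=> m0; have ln2 : 0 < ln 2 :> R by rewrite ln_gt0 // ltr1n.
rewrite ceil_le_int /log2 ler_pdivrMr // -(ler_nat R) natrX.
rewrite -[in RHS]ler_ln ?posrE ?exprn_gt0 ?ltr0n // lnXn ?ltr0n //.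
by rewrite mulr_natl.
Qed.

Theorem theorem1 (R : realType) (G : sgraph)
    (hG : interval_graph R G) (hE : exists u v : G, adj u v) :
  Num.ceil (log2 ((claw_number G)%:R : R)) <= (cubicity R G)%:Z
    <= Num.ceil (log2 ((claw_number G)%:R : R)) + 2.
Proof.
have [psi0 sG _] := claw_numberP hE; have [_ cubG minG] := cubicityP R G.
apply/andP; split; first by rewrite ceil_log2_le // (star_le_cube sG cubG).
have log0 : 0 <= log2 ((claw_number G)%:R : R).
  by rewrite /log2 divr_ge0 ?ln_ge0 ?ler1n.
have : 0 <= Num.ceil (log2 ((claw_number G)%:R : R)).
  by rewrite ceil_ge0 (lt_le_trans _ log0) // ltrN10.
(* The ceiling, being nonnegative, is a natural number [t] and serves as the number of level
   bits. *)
case E : (Num.ceil _) => [t|//] _.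
have ht : (claw_number G <= 2 ^ t)%N by rewrite -(ceil_log2_le R) // E.
have [l [r [lr adjE small]]] := interval_graph_small hG.
have := minG t.+2 isT (cube_representable_interval lr adjE small ht).
by rewrite -PoszD addn2 lez_nat.
Qed.
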